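(* Let $R$ be a commutative ring and let $P(x,y)=y-\sum_{i=1}^dA_i(x)\Phi^i(y)$ be an isolating Z-Mahler equation over $R$ of exponent $d$ and height $h$. Let $f=\sum_{n\geq0}f_nx^n\in R[[x]]$ be a solution of $P(x,f(x))=0$, and let $\mathcal{A}=\mathcal{A}(P,f_0)$ be the weighted automaton associated to $P$ and $f_0$. Then $\mathrm{weight}_{\mathcal{A}}(w)=f_{[w]_Z}$ for any word $w\in\{0,1\}^*$. Consequently, there is a constant $C$, depending only on the golden ratio $\varphi$, such that if $R$ is finite (and $h\ge 1$), then there exists a deterministic automaton with output, with at most $|R|^{Cdh^2}$ states, that generates $f(x)$ in the Zeckendorf numeration.
   Context: Zeckendorf numeration: let $F_{-2}=0$, $F_{-1}=1$, $F_n=F_{n-1}+F_{n-2}$ for $n\geq 0$. For a word $w=w_k\cdots w_0$ over a finite set of integers, $[w]_Z=\sum_i w_iF_i$. For $n\in\mathbb{N}$, $(n)_Z$ is the unique word over $\{0,1\}$ with $[(n)_Z]_Z=n$, no two consecutive $1$s and no leading zero (it may be padded with leading zeros when needed). Define $\phi:\mathbb{N}\to\mathbb{N}$ by $\phi(n)=[(n)_Z0]_Z$, and the linearity defect $\delta(m,n)=\phi(m+n)-\phi(m)-\phi(n)$, which always lies in $\{-1,0,1\}$. For words $u,v$ (padded on the left with zeros to equal length), $u\boxminus v$ is the digitwise difference. Z-Mahler equations: $\Phi(\sum f_nx^n)=\sum f_nx^{\phi(n)}$ on $R[[x]]$. An isolating Z-Mahler equation is $P(x,y)=y-\sum_{i=1}^dA_i(x)\Phi^i(y)=0$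 with $A_i(x)=\sum_{j=0}^h\alpha_{i,j}x^j\in R[x]$; $d$ is its exponent and the maximal degree $h$ of the $A_i$ its height. Put $\alpha_{i,j}=0$ for other indices. Weighted automaton: a tuple $(S,B,\Delta,I,F)$ with $S$ finite, $I,F:S\to R$ and transition weights in $R$ ($s\xrightarrow{b:r}s'$ is a transition with label $b$ and weight $r$; unlisted transitions have weight $0$). A path labelled $b_1\cdots b_n$ through $s_0,\dots,s_n$ with weights $r_1,\dots,r_n$ has weight $I(s_0)r_1\cdots r_nF(s_n)$. $\mathrm{weight}_{\mathcal A}(w)$ is the sum of the weights of all paths labelled $w$. A deterministic automaton with output is $(S,B,\Delta,s_0,\tau)$ with $S$ finite, $\Delta:S\times B\to S$ extended to words, and $\tau:S\to R$. It generates $f$ if $f_n=\tau(\Delta(s_0,(n)_Z))$ for all $n\ge 0$. The automaton $\mathcal{A}(P,f_0)$: let $B=\{0,1\}$ and $\bar B=\{-1,0,1\}$. Fix a deterministic automaton with output $\mathcal{D}=(Q,\bar B,\Gamma,q_0,\tau)$, $\tau:Q\to\bar B$, such that $\Gamma(q_0,0)=q_0$ and $\tau(\Gamma(q_0,(m)_Z\boxminus(n)_Z))=\delta(m-n,n)$ for all $m\ge n\ge0$ (such an automaton exists). Put $\tilde h=\left\lfloor\frac{h+3-\varphi}{\varphi-1}\right\rfloor$ with $\varphi=(1+\sqrt5)/2$, and let $g=|(\tilde h)_Z|$ be the length of $(\tilde h)_Z$. The states are $s_{i,j,q,u}$ with $0\le i\le d$, $0\le j\le\tilde h$, $q\in Q$,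 $u\in B^g$. Put $\hat\delta(s_{i,j,q,u})=\tau(\Gamma(q,u\boxminus(j)_Z))$, where $(j)_Z$ is padded to length $g$. The transitions are as follows, for $a,b\in B$, $u\in B^{g-1}$, $0\le i\le d-1$, $0\le j\le\tilde h$, with $\ell=\phi(j)+\hat\delta(s_{i,j,q,au})+b$: (1) $s_{i,j,q,au}\xrightarrow{b:1}s_{i+1,\ell,\Gamma(q,a),ub}$ whenever $0\le\ell\le\tilde h$; (2) $s_{i,j,q,au}\xrightarrow{b:\alpha_{i+1,\ell-k}}s_{0,k,\Gamma(q,a),ub}$ for every $0\le k\le\tilde h$ such that $\ell\ge 0$ and $0\le\ell-k\le h$. Initial weights: $I(s_{i,j,q,u})=f_0$ if $j=0$, $q=q_0$, $u=0^g$, and $0$ otherwise. Final weights: $F(s_{i,j,q,u})=1$ if $i=j=0$, and $0$ otherwise.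
   Formalization: The weight identity is stated only for words w with no two consecutive 1s (leading zeros allowed), because it fails for arbitrary words: for f=(1+x^2)Φ(f) with f_0=1, the word 11 has weight 0 while f_3=1. *)

(* Defs.v *)
From HB Require Import structures.
From mathcomp Require Import all_boot all_order all_algebra.
From mathcomp Require Import realalg.

Set Implicit Arguments.
Unset Strict Implicit.
Unset Printing Implicit Defensive.

Import Order.TTheory GRing.Theory Num.Theory.
Local Open Scope ring_scope.

(* Fibonacci numbers are indexed from -2 (F_{-2} = 0, F_{-1} = 1): [fib n] is
   F_{n-2}, and [zfib i] is F_i for i >= 0, i.e. 1, 2, 3, 5, ... *)
Fixpoint fib (n : nat) : nat :=
  match n with
  | 0 => 0
  | 1 => 1
  | (n''.+1 as n').+1 => fib n' + fib n''
  end%N.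

Definition zfib (i : nat) : nat := fib i.+2.

(* Words are read from left to right, most significant digit first, so the
   digit w_i is the i-th letter from the right. *)
Definition zval (w : seq bool) : nat :=
  (\sum_(i < size w) nth false (rev w) i * zfib i)%N.

(* A word over {0,1} without factor 11: some (n)_Z padded with leading zeros.
   The automaton [mahler_waut] below may be wrong on other words: for
   f = (1 + x^2) Phi(f) one has f_3 = f_0, but the word 11, of value 3, has
   weight 0. *)
Definition no11 (w : seq bool) : bool := sorted (fun a b => ~~ (a && b)) w.

Definition is_zeck (n : nat) (w : seq bool) : bool :=
  [&& no11 w, head true w & zval w == n].

Lemma zval_cons a w : zval (a :: w) = (a * zfib (size w) + zval w)%N.
Proof.
rewrite /zval /= big_ord_recr /= rev_cons nth_rcons size_rev ltnn eqxx addnC.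
congr addn; apply: eq_bigr => i _.
by rewrite nth_rcons size_rev ltn_ord.
Qed.

Lemma zfibSS i : zfib i.+2 = (zfib i.+1 + zfib i)%N.
Proof. by []. Qed.

Lemma zfib_gt i : (i < zfib i)%N.
Proof.
suff : (i < zfib i)%N && (i.+1 < zfib i.+1)%N by case/andP.
elim: i => // i /andP[h1 h2]; rewrite h2 zfibSS /= -addn1.
by apply: (@leq_add i.+2 1) => //; apply: leq_trans h1.
Qed.

Lemma leq_zfib : {homo zfib : i j / (i <= j)%N}.
Proof.
apply: homo_leq => //; first exact: leq_trans.
by case=> // i; rewrite zfibSS leq_addr.
Qed.

Lemma zeck_padded k n : (n < zfib k)%N ->
  exists w, [/\ size w = k, no11 w & zval w = n].
Proof.
move: n; suff : forall i n, (i <= k)%N -> (n < zfib i)%N ->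
    exists w, [/\ size w = i, no11 w & zval w = n].
  by move=> H n; apply: H.
elim/ltn_ind: k => k IH; case=> [|[|i]] n le_ik.
- by case: n => // _; exists [::]; rewrite /zval big_ord0.
- case: n => [|[|n]] // _; [exists [:: false] | exists [:: true]];
  by rewrite zval_cons /zval /= big_ord0.
case: (ltnP n (zfib i.+1)) => [lt_n _ | ge_n lt_n].
  have [w [sz h v]] := IH _ le_ik _ n (leqnn _) lt_n.
  exists (false :: w); rewrite zval_cons /= sz v; split=> //.
  by case: w h {sz v}.
have lt_n' : (n - zfib i.+1 < zfib i)%N by rewrite ltn_subLR.
have [w [sz h v]] := IH _ le_ik i _ (leqnSn _) lt_n'.
exists [:: true, false & w]; rewrite !zval_cons /= sz v mul1n mul0n add0n subnKC //.
by split=> //; case: w h {sz v}.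
Qed.

Lemma zeck_exists n : exists w, is_zeck n w.
Proof.
have [w [_ h v]] := zeck_padded (zfib_gt n).
elim: w h v => [|[] w IH] h v; first by exists [::]; rewrite /is_zeck v eqxx.
  by exists (true :: w); rewrite /is_zeck h v eqxx.
by apply: IH; [exact: path_sorted h | rewrite -v zval_cons].
Qed.

(* (n)_Z; that it is the only such word is [zeck_uniq]. *)
Definition zeck (n : nat) : seq bool := xchoose (zeck_exists n).

Lemma zeckP n : is_zeck n (zeck n).
Proof. exact: xchooseP. Qed.

Lemma zval_lt w : no11 w -> (zval w < zfib (size w))%N.
Proof.
have [n] := ubnP (size w); elim: n w => // n IH [|[] w] /=.
- by rewrite /zval big_ord0.
- case: w => [|[] w] //=; first by rewrite zval_cons /zval big_ord0.
  move=> sz h; rewrite !zval_cons /= mul1n mul0n add0n zfibSS ltn_add2l.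
  by apply: IH; [exact: ltnW | exact: path_sorted h].
move=> sz h; rewrite zval_cons mul0n add0n.
by apply: leq_trans (IH w sz (path_sorted h)) _; apply: leq_zfib.
Qed.

Lemma zval_inj u v : size u = size v -> no11 u -> no11 v ->
  zval u = zval v -> u = v.
Proof.
elim: u v => [|a u IH] [|b v] //= [sz] hu hv; rewrite !zval_cons -sz.
have lu := zval_lt (path_sorted hu); have lv := zval_lt (path_sorted hv).
rewrite -sz in lv.
have {}IH := IH v sz (path_sorted hu) (path_sorted hv).
case: a hu; case: b hv => hv hu; rewrite ?mul1n ?mul0n ?add0n.
- by move/addnI/IH ->.
- by move=> e; move: lv; rewrite -e ltnNge leq_addr.
- by move=> e; move: lu; rewrite e ltnNge leq_addr.
by move/IH ->.
Qed.

Lemma zeck_uniq n w : is_zeck n w -> w = zeck n.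
Proof.
have le_sz u v : is_zeck n u -> is_zeck n v -> (size u <= size v)%N.
  case: u => [|a u] // /and3P[_ /= a1 /eqP hu] /and3P[hv _ /eqP ev].
  rewrite a1 in hu; rewrite leqNgt; apply/negP => /= lt_vu.
  have := zval_lt hv; rewrite ltnNge ev -hu zval_cons mul1n => /negP; apply.
  by apply: leq_trans (leq_zfib _) (leq_addr _ _).
move=> hw; have hz := zeckP n.
have sz : size w = size (zeck n) by apply/anti_leq; rewrite !le_sz.
case/and3P: hw => hw _ /eqP ew; case/and3P: hz => hz _ /eqP ez.
by apply: zval_inj => //; rewrite ez.
Qed.

Definition zphi (n : nat) : nat := zval (rcons (zeck n) false).

Definition defect (m n : nat) : int :=
  (zphi (m + n))%:Z - (zphi m)%:Z - (zphi n)%:Z.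

(* The alphabet {-1,0,1}; [\val] gives the integer value of a letter. *)
Definition bbar : finType := seq_sub [:: -1; 0; 1 : int].

Lemma bdiff_subproof (a b : bool) : a%:Z - b%:Z \in [:: -1; 0; 1 : int].
Proof. by case: a; case: b. Qed.

Definition bdiff (a b : bool) : bbar := SeqSub (bdiff_subproof a b).

(* The inclusion of {0,1} in {-1,0,1}. *)
Definition bbar_of (a : bool) : bbar := bdiff a false.

Definition lpad (N : nat) (w : seq bool) : seq bool :=
  nseq (N - size w) false ++ w.

Definition boxminus (u v : seq bool) : seq bbar :=
  let N := maxn (size u) (size v) in
  [seq bdiff p.1 p.2 | p <- zip (lpad N u) (lpad N v)].

(* Deterministic automata with output. *)
Record daut (B : finType) (O : Type) := DAut {
  da_state : finType;
  da_trans : da_state -> B -> da_state;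
  da_init : da_state;
  da_out : da_state -> O
}.

Definition da_run (B : finType) (O : Type) (M : daut B O) (w : seq B) :
  da_state M := foldl (@da_trans B O M) (da_init M) w.

Definition generates (R : Type) (M : daut bool R) (f : nat -> R) : Prop :=
  forall n : nat, f n = da_out (da_run M (zeck n)).

Definition defect_automaton (D : daut bbar bbar) : Prop :=
  da_trans (da_init D) (bbar_of false) = da_init D /\
  forall m n : nat, (n <= m)%N ->
    \val (da_out (da_run D (boxminus (zeck m) (zeck n)))) = defect (m - n) n.

(* Weighted automata; a transition that is not listed has weight 0, so that
   the transition relation is a weight function. *)
Record waut (B : finType) (R : Type) := WAut {
  wa_state : finType;
  wa_trans : wa_state -> B -> wa_state -> R;
  wa_init : wa_state -> R;
  wa_final : wa_state -> R
}.

Section Weight.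
Variables (B : finType) (R : comNzRingType) (M : waut B R).

Definition path_weight (w : seq B)
    (s : {ffun 'I_(size w).+1 -> wa_state M}) : R :=
  wa_init (s ord0) *
  (\prod_(i < size w)
     wa_trans (s (widen_ord (leqnSn _) i)) (tnth (in_tuple w) i)
       (s (lift ord0 i))) *
  wa_final (s ord_max).

Definition weight (w : seq B) : R :=
  \sum_(s : {ffun 'I_(size w).+1 -> wa_state M}) path_weight s.

End Weight.

(* A formal power series over R is its coefficient function nat -> R. *)
Section Mahler.
Variable R : comNzRingType.

(* Phi (sum_n f_n x^n) = sum_n f_n x^(zphi n): the coefficient of x^m is the
   sum of the f_n with zphi n = m, and n <= zphi n for all n. *)
Definition Phi (f : nat -> R) (m : nat) : R :=
  \sum_(n < m.+1 | zphi n == m) f n.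

Definition poly_mul_series (p : {poly R}) (f : nat -> R) (n : nat) : R :=
  \sum_(j < n.+1) p`_j * f (n - j)%N.

(* An isolating equation of exponent d is given by the tuple
   A = (A_1, ..., A_d), so that A_{i+1} is the component of index i : 'I_d. *)
Definition mahlerP d (A : d.-tuple {poly R}) (y : nat -> R) (n : nat) : R :=
  y n - \sum_(i < d) poly_mul_series (tnth A i) (iter i.+1 Phi y) n.

Definition mahler_solution d (A : d.-tuple {poly R}) (f : nat -> R) : Prop :=
  forall n, mahlerP A f n = 0.

Definition height d (A : d.-tuple {poly R}) : nat :=
  \max_(i < d) (size (tnth A i)).-1.

(* alpha_{i,j}, the coefficient of x^j in A_i, and 0 for the other indices. *)
Definition alpha d (A : d.-tuple {poly R}) (i j : nat) : R :=
  if i is i'.+1 then (nth 0 A i')`_j else 0.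

End Mahler.

Definition golden : realalg := (1 + Num.sqrt 5%:R) / 2%:R.

(* The argument of the floor is nonnegative, hence the use of [Num.truncn]. *)
Definition htilde (h : nat) : nat :=
  Num.truncn ((h%:R + 3%:R - golden) / (golden - 1)).

Definition window (h : nat) : nat := size (zeck (htilde h)).

Section Automaton.
Variables (R : comNzRingType) (D : daut bbar bbar).
Variables (d : nat) (A : d.-tuple {poly R}) (f0 : R).

Let h := height A.

(* The state s_{i,j,q,u} is (i, j, q, u). *)
Definition mstate : finType :=
  ('I_d.+1 * 'I_(htilde h).+1 * da_state D * (window h).-tuple bool)%type.

Definition defect_hat (s : mstate) : int :=
  let: (i, j, q, u) := s in
  \val (da_out (foldl (@da_trans _ _ D) q (boxminus u (zeck j)))).

(* The window a u of the source becomes u b in the target. Transitions of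
   type (1) have a target with i' > 0, those of type (2) a target with
   i' = 0. *)
Definition mtrans (s : mstate) (b : bool) (s' : mstate) : R :=
  let: (i, j, q, u) := s in
  let: (i', j', q', u') := s' in
  let l : int := (zphi j)%:Z + defect_hat s + b%:Z in
  if [&& (i < d)%N, q' == da_trans q (bbar_of (head false u))
       & tval u' == rcons (behead u) b] then
    if [&& i' == i.+1 :> nat, 0 <= l <= (htilde h)%:Z & j'%:Z == l] then 1
    else if [&& i' == 0%N :> nat, 0 <= l & 0 <= l - j'%:Z <= h%:Z] then
      alpha A i.+1 `|l - j'%:Z|%N
    else 0
  else 0.

Definition minit (s : mstate) : R :=
  let: (i, j, q, u) := s in
  if [&& j == 0%N :> nat, q == da_init D & u == nseq_tuple (window h) false]
  then f0 else 0.

Definition mfinal (s : mstate) : R :=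
  let: (i, j, q, u) := s in
  if (i == 0%N :> nat) && (j == 0%N :> nat) then 1 else 0.

Definition mahler_waut : waut bool R := WAut mtrans minit mfinal.

End Automaton.

(* Main.v *)
Require Import Defs.
From mathcomp Require Import all_boot all_order all_algebra.
From mathcomp Require Import realalg zify ring lra.
From Stdlib Require Import ClassicalEpsilon.

Set Implicit Arguments.
Unset Strict Implicit.
Unset Printing Implicit Defensive.

Import Order.TTheory GRing.Theory Num.Theory.
Local Open Scope ring_scope.

(* Every N is uniquely zphi m + c with c a digit that may follow (m)_Z, and
   zphi N = zphi m + m + 2c. Hence the coefficient of x^(zphi n + b - l) in
   Phi g is g_(n - j) for the unique j with zphi n - zphi (n - j) + b = l, and
   is 0 if there is no such j; the real estimate of zphi n - golden * n yields
   j <= htilde h as soon as l <= h + htilde h. With the Mahler equation this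
   computes the coefficients (Phi^i f)_(N - l), l <= htilde h, for
   N = zphi n + b from those for n.

   For the weighted automaton, the total weight of the paths labelled w from
   the initial states to s_{i,j,q,u} is therefore (Phi^i f)_([w]_Z - j) if (q,u)
   is the configuration reached by reading w, and 0 otherwise.

   A deterministic automaton has to remember the coefficients
   (Phi^i f)_(n - j), i < d, and the differences zphi n - zphi (n - j), for
   j <= htilde h. These differences determine the differences for zphi n + b,
   so that the defect automaton is not needed here. *)

(** * Zeckendorf words and the recursive structure of [zphi] *)

Lemma zval_nseq_cat k w : zval (nseq k false ++ w) = zval w.
Proof. by elim: k => //= k IH; rewrite zval_cons mul0n. Qed.

Lemma zval_rcons w c : zval (rcons w c) = (zval (rcons w false) + c)%N.
Proof.
elim: w => [|a w IH] /=; first by rewrite !zval_cons /zval big_ord0 /= /zfib /=; lia.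
by rewrite !zval_cons !size_rcons IH addnA.
Qed.

(** The recurrence F_{i+2} = F_{i+1} + F_i is applied to each digit of w; the digit c ends in
    position 1 and counts F_1 = 2 times. *)
Lemma zval_rcons2 w c :
  zval (rcons (rcons w c) false) = (zval (rcons w false) + zval w + c.*2)%N.
Proof.
elim: w => [|a w IH] /=; first by rewrite !zval_cons /zval big_ord0 /= /zfib /=; lia.
by rewrite !zval_cons !size_rcons IH zfibSS; lia.
Qed.

Lemma no11_rcons w c : no11 (rcons w c) = no11 w && ~~ (last false w && c).
Proof. by case: w => [|a w]; rewrite /no11 //= rcons_path. Qed.

Lemma zeck_no11 n : no11 (zeck n).
Proof. by case/and3P: (zeckP n). Qed.

Lemma zeckK n : zval (zeck n) = n.
Proof. by case/and3P: (zeckP n) => _ _ /eqP. Qed.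

Lemma no11_zeck w : no11 w -> exists k, w = nseq k false ++ zeck (zval w).
Proof.
elim: w => [|[] w IH] nw.
- exists 0%N; apply: zeck_uniq; by rewrite /is_zeck /= eqxx.
- by exists 0%N; apply: zeck_uniq; rewrite /is_zeck nw eqxx.
have [k wE] := IH (path_sorted nw); exists k.+1.
by rewrite zval_cons mul0n add0n /= -wE.
Qed.

(** Used to see that the expansion of every j up to [htilde h] fits into the window, whose length is
    that of the expansion of [htilde h]. *)
Lemma size_zeck_homo : {homo (fun n => size (zeck n)) : m n / (m <= n)%N}.
Proof.
move=> m n le_mn; rewrite leqNgt; apply/negP => lt_sz.
have := zval_lt (zeck_no11 n); rewrite zeckK => lt_n.
have /and3P[_ hd _] := zeckP m; have := zeckK m.
case: (zeck m) lt_sz hd => // a w lt_sz /= ->; rewrite zval_cons mul1n => mE.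
have := @leq_zfib (size (zeck n)) (size w) lt_sz; lia.
Qed.

(** A digit 1 may follow the expansion of n exactly when this is false; the default value makes this
    correct for n = 0, whose expansion is empty. *)
Definition lastd (n : nat) : bool := last false (zeck n).

Lemma zphi_zval w : no11 w -> zphi (zval w) = zval (rcons w false).
Proof.
by move=> /no11_zeck[k {2}->]; rewrite rcons_cat zval_nseq_cat.
Qed.

Lemma lastd_zval w : no11 w -> lastd (zval w) = last false w.
Proof.
move=> /no11_zeck[k {2}->]; rewrite last_cat /lastd; congr last.
by elim: k.
Qed.

Lemma lastd_zphi n c : ~~ (lastd n && c) -> lastd (zphi n + c) = c.
Proof.
move=> nc; rewrite /zphi -zval_rcons lastd_zval ?last_rcons //.
by rewrite no11_rcons zeck_no11.
Qed.

Lemma zphi_zphi n c : ~~ (lastd n && c) ->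
  zphi (zphi n + c) = (zphi n + n + c.*2)%N.
Proof.
move=> nc.
have -> : (zphi n + c)%N = zval (rcons (zeck n) c) by rewrite zval_rcons.
by rewrite zphi_zval ?zval_rcons2 ?zeckK // no11_rcons zeck_no11.
Qed.

Lemma zphi0 : zphi 0 = 0%N.
Proof.
have := zphi_zval (erefl : no11 [::]).
by rewrite zval_cons /zval big_ord0 mul0n.
Qed.

Lemma zphi_gt n : (0 < n)%N -> (n < zphi n)%N.
Proof.
have zfibS i : (zfib i < zfib i.+1)%N.
  by case: i => // i; rewrite zfibSS; have := zfib_gt i; lia.
rewrite /zphi -{1 2}(zeckK n); elim: (zeck n) => [|a w IH] /=.
  by rewrite /zval big_ord0.
rewrite !zval_cons size_rcons; have := zfibS (size w).
by case: (posnP (zval w)) IH => [->|_ /(_ isT)]; case: a; lia.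
Qed.

(** Take for m the value of the expansion of n without its last digit. *)
Lemma zphi_decomp n : exists m, ~~ (lastd m && lastd n) /\ n = (zphi m + lastd n)%N.
Proof.
have := zeckK n; have := zeck_no11 n; rewrite /lastd.
elim/last_ind: (zeck n) => [|w c _].
  by move=> _ <-; exists 0%N; rewrite andbF zphi0 /zval big_ord0.
rewrite no11_rcons last_rcons => /andP[nw nc] <-; exists (zval w).
by rewrite zphi_zval // -zval_rcons -/(lastd _) lastd_zval.
Qed.

Lemma lastd0 : lastd 0 = false.
Proof.
by rewrite /lastd -(zeck_uniq (w:=[::])) // /is_zeck /zval big_ord0.
Qed.

(** Strong induction, with n = zphi m + c. If m and n both end in 0, then n + 1 = zphi m + 1;
    otherwise the induction hypothesis gives n + 1 = zphi (m + 1). In both cases [zphi_zphi]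
    computes the value at n + 1. *)
Lemma zphiS n : zphi n.+1 = (zphi n + 2 - lastd n)%N.
Proof.
elim/ltn_ind: n => n IH; have [m [nm nE]] := zphi_decomp n.
have [n0|n_gt0] := posnP n.
  rewrite n0 zphi0 lastd0.
  have e : zval [:: true] = 1%N by rewrite zval_cons /zval big_ord0.
  by rewrite -e zphi_zval // !zval_cons /zval big_ord0.
have lt_mn : (m < n)%N.
  have [m0|/zphi_gt] := posnP m; [by rewrite m0|].
  by lia.
have := IH m lt_mn; have := zphi_zphi nm; rewrite -nE.
have := @zphi_zphi m.+1 false; rewrite andbF addn0 => /(_ isT).
have := @zphi_zphi m true.
case: (lastd n) nm nE; case: (lastd m) => //= _ nE e0 e1 e2 e3.
- have -> : n.+1 = zphi m.+1 by lia.
  by rewrite e1; lia.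
- have -> : n.+1 = zphi m.+1 by lia.
  by rewrite e1; lia.
have -> : n.+1 = (zphi m + 1)%N by lia.
by rewrite e0 //; lia.
Qed.

(** * Estimates with the golden ratio *)

Lemma golden_sqr : golden * golden = golden + 1.
Proof.
have s5 : Num.sqrt 5%:R * Num.sqrt 5%:R = 5%:R :> realalg.
  by rewrite -expr2 sqr_sqrtr ?ler0n.
by rewrite /golden; move: s5; set s := Num.sqrt _ => s5; field: s5.
Qed.

Lemma golden_bounds : 3%:R / 2%:R < golden < 5%:R / 3%:R.
Proof.
have g0 : 0 < golden.
  by rewrite divr_gt0 ?ltr0n // ltr_pwDl ?sqrtr_ge0.
have := golden_sqr; move: golden g0 => g g0 gg.
by apply/andP; split; nra.
Qed.

(* The error is the value at the conjugate 1 - golden, so that appending a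
   digit multiplies it by 1 - golden. *)
Lemma zphi_error n :
  let e := (zphi n)%:R - golden * n%:R in
  if lastd n then 2%:R * golden - 3%:R < e < golden - 1
  else golden - 2%:R < e < 2%:R * golden - 3%:R.
Proof.
elim/ltn_ind: n => n IH /=; have [m [nm nE]] := zphi_decomp n.
have gg := golden_sqr; have /andP[g1 g2] := golden_bounds.
have [n0|n_gt0] := posnP n.
  by rewrite n0 lastd0 zphi0; apply/andP; split; lra.
have lt_mn : (m < n)%N.
  have [m0|/zphi_gt] := posnP m; [by rewrite m0|].
  by lia.
have /= := IH m lt_mn; have := zphi_zphi nm; rewrite -nE => ->.
move: (lastd n) nm nE => c nm ->; set e := (zphi m)%:R - _.
have -> : (zphi m + m + c.*2)%:R - golden * (zphi m + c)%:R =
   (1 - golden) * e + (2%:R - golden) * c%:R.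
  rewrite -muln2 /e !(natrD, natrM); ring: gg.
case: c nm; case: (lastd m) => //= _ /andP[e1 e2]; apply/andP; split; nra.
Qed.

Lemma zphi_mono : {mono zphi : m n / (m <= n)%N}.
Proof.
apply: leq_mono; apply: homo_ltn => [|n]; first exact: ltn_trans.
by rewrite zphiS; case: lastd; lia.
Qed.

Lemma zphi_sub_le n j : (zphi n - zphi (n - j) <= j.*2)%N.
Proof.
elim: j n => [|j IH] [|n]; rewrite ?subn0 ?subnn //.
by rewrite subSS zphiS; have := IH n; lia.
Qed.

Lemma htilde_gt h : (0 < htilde h)%N.
Proof.
have /andP[g1 g2] := golden_bounds.
rewrite truncn_gt0 ler_pdivlMr; last lra.
have := ler0n realalg h; lra.
Qed.

Lemma htilde_lt h : h%:R + 3%:R - golden < (golden - 1) * (htilde h).+1%:R.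
Proof.
have /andP[g1 g2] := golden_bounds.
rewrite mulrC -ltr_pdivrMr; last lra.
by rewrite truncnS_gt.
Qed.

Lemma htilde_le h : (0 < h)%N -> (htilde h <= 4 * h)%N.
Proof.
have /andP[g1 g2] := golden_bounds => h_gt0.
have h1 : 1 <= h%:R :> realalg by rewrite ler1n.
rewrite truncn_le_nat ltr_pdivrMr; last lra.
rewrite -[(4 * h).+1]addn1 natrD natrM; nra.
Qed.

(** The errors of [zphi] lie in an open interval of length 1, so the difference exceeds golden * j -
    1. If j were larger than H = htilde h, this would give (golden - 1) * (H + 1) < h + 1, against
    [htilde_lt]. The successor in the bound leaves room for a digit c when zphi n + b = l + zphi (n
    - j) + c with l <= h + H. *)
Lemma htildeP h n j : (j <= n)%N ->
  (zphi n - zphi (n - j) <= (h + htilde h).+1)%N -> (j <= htilde h)%N.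
Proof.
move=> le_jn; apply: contraTT; rewrite -!ltnNge => lt_j.
have gg := golden_sqr; have /andP[g1 g2] := golden_bounds.
have err k : golden - 2%:R < (zphi k)%:R - golden * k%:R < golden - 1.
  have /= := zphi_error k.
  by case: lastd => /andP[e1 e2]; apply/andP; split; lra.
have /andP[_ e1] := err (n - j)%N; have /andP[e2 _] := err n.
have := htilde_lt h; set H := htilde h in lt_j *.
rewrite natrB // in e1.
have {}lt_j : H.+1%:R <= j%:R :> realalg by rewrite ler_nat.
have le_z : (zphi (n - j) <= zphi n)%N by rewrite zphi_mono leq_subr.
move=> lt_h; rewrite -(ltr_nat realalg) natrB //.
rewrite -addn1 -[H.+1]addn1 !natrD in lt_h lt_j *.
nra.
Qed.

Lemma lastd_zphiF n : lastd (zphi n) = false.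
Proof. by have := @lastd_zphi n false; rewrite addn0 andbF; apply. Qed.

Lemma zphi_inj : injective zphi.
Proof. exact: incn_inj zphi_mono. Qed.

(** * Coefficients of x^j * Phi g and of the Mahler equation *)

Section Shift.
Variable R : comNzRingType.
Implicit Types g f : nat -> R.

(* The coefficient of x^n in x^j * g. *)
Definition shift g n j : R := if (j <= n)%N then g (n - j)%N else 0.

Lemma Phi_zphi g n : Phi g (zphi n) = g n.
Proof.
rewrite /Phi.
have lt_n : (n < (zphi n).+1)%N by case: n => // n; rewrite ltnS ltnW ?zphi_gt.
rewrite (big_pred1 (Ordinal lt_n)) // => i /=.
by rewrite (inj_eq zphi_inj) -val_eqE.
Qed.

Lemma Phi_lastd g n : lastd n -> Phi g n = 0.
Proof.
move=> ln; rewrite /Phi big_pred0 // => i.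
by apply/eqP => e; move: ln; rewrite -e lastd_zphiF.
Qed.

Lemma iter_Phi0 i g : iter i (@Phi R) g 0%N = g 0%N.
Proof. by elim: i => //= i <-; rewrite -[in LHS]zphi0 Phi_zphi. Qed.

Lemma zphi_sub_decomp n (b : bool) l :
  ~~ (lastd n && b) -> (l <= zphi n + b)%N ->
  exists j (c : bool), [/\ (j <= n)%N, ~~ (lastd (n - j)%N && c) &
    (zphi n + b = l + (zphi (n - j) + c))%N].
Proof.
move=> nb le_l; have [m [mc E]] := zphi_decomp (zphi n + b - l)%N.
have le_mn : (m <= n)%N.
  (* Otherwise zphi m would be at least zphi (n + 1) = zphi n + 2 - lastd n, which exceeds zphi n +
     b because [lastd n] and b are not both 1. *)
  rewrite leqNgt; apply/negP => lt_nm.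
  have := zphiS n; rewrite -zphi_mono in lt_nm.
  by move: E nb lt_nm; case: (lastd n); case: b {le_l mc} => //=; lia.
exists (n - m)%N, (lastd (zphi n + b - l)).
by rewrite leq_subr subKn //; split=> //; lia.
Qed.

Lemma shift_Phi h g n (b : bool) l :
  ~~ (lastd n && b) -> (l <= h + htilde h)%N ->
  shift (Phi g) (zphi n + b) l =
  \sum_(j < (htilde h).+1 | (j <= n)%N && (zphi n - zphi (n - j) + b == l)%N)
    shift g n j.
Proof.
move=> nb le_lh; have le_z k : (zphi (n - k) <= zphi n)%N.
  by rewrite zphi_mono leq_subr.
rewrite /shift; case: leqP => le_l; last first.
  rewrite big_pred0 // => j; apply/negbTE; rewrite negb_and orbC.
  by have := le_z j; case: eqP => //=; lia.
have [j [c [le_jn jc E]]] := zphi_sub_decomp nb le_l.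
have -> : (zphi n + b - l = zphi (n - j) + c)%N by lia.
(* For c = 1 the index zphi n + b - l ends in the digit 1, hence is no value of [zphi], and both
   sides vanish. For c = 0 injectivity of [zphi] leaves only j in the sum. *)
case: c jc E => jc E.
  rewrite Phi_lastd ?lastd_zphi // big_pred0 // => k.
  apply/negbTE; rewrite negb_and orbC; case: eqP => //= ek.
  have {ek}ek : (zphi (n - k) = zphi (n - j) + true)%N by have := le_z k; lia.
  by have := lastd_zphi jc; rewrite -ek lastd_zphiF.
rewrite addn0 Phi_zphi; have lt_j : (j < (htilde h).+1)%N.
  by rewrite ltnS; apply: (@htildeP h n) => //; lia.
rewrite (big_pred1 (Ordinal lt_j)) /= ?le_jn // => k /=; rewrite -val_eqE /=.
apply/andP/eqP => [[le_kn /eqP e]|->]; last first.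
  by rewrite le_jn; split=> //; apply/eqP; have := le_z j; lia.
have /zphi_inj : zphi (n - k) = zphi (n - j) by have := le_z k; lia.
by lia.
Qed.

Lemma poly_mul_series_shift h (p : {poly R}) g n k :
  (size p <= h.+1)%N ->
  shift (poly_mul_series p g) n k = \sum_(t < h.+1) p`_t * shift g n (k + t).
Proof.
move=> le_p; rewrite /shift /poly_mul_series; case: leqP => le_k; last first.
  by rewrite big1 // => t _; rewrite leqNgt ltn_addr // mulr0.
(* Both sums have the same summand F; it vanishes for t > n - k because of the shift, and for t > h
   because of the degree of p. *)
pose F t := p`_t * (if (k + t <= n)%N then g (n - (k + t))%N else 0).
rewrite -[RHS]/(\sum_(t < h.+1) F t).
have -> : \sum_(j < (n - k).+1) p`_j * g (n - k - j)%N =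
    \sum_(j < (n - k).+1) F j.
  apply: eq_bigr => j _; have := ltn_ord j; rewrite ltnS => le_j.
  by rewrite /F -subnDA ifT //; lia.
have widen a c : (a <= c)%N -> (forall t, (a <= t)%N -> F t = 0) ->
    \sum_(t < a) F t = \sum_(t < c) F t.
  move=> le_ac F0; rewrite (big_ord_widen c) // big_mkcond; apply: eq_bigr => t _.
  by case: ltnP => // /F0.
case: (leqP (n - k).+1 h.+1) => le_nh.
  by apply: widen => // t le_t; rewrite /F ifF ?mulr0 //; lia.
apply/esym/widen; first exact: ltnW.
by move=> t le_t; rewrite /F nth_default ?mul0r // (leq_trans le_p).
Qed.

Lemma mahler_shift d (A : d.-tuple {poly R}) f n k :
  mahler_solution A f ->
  shift f n k = \sum_(i < d) \sum_(t < (height A).+1)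
    alpha A i.+1 t * shift (iter i.+1 (@Phi R) f) n (k + t).
Proof.
move=> sol; have szA (i : 'I_d) : (size (tnth A i) <= (height A).+1)%N.
  apply: leq_trans (leqSpred _) _; rewrite ltnS.
  exact: (leq_bigmax (F := fun i : 'I_d => (size (tnth A i)).-1)).
transitivity (\sum_(i < d)
    shift (poly_mul_series (tnth A i) (iter i.+1 (@Phi R) f)) n k).
  rewrite /shift; case: leqP => _; last by rewrite big1.
  by apply/eqP; rewrite -subr_eq0; apply/eqP/sol.
apply: eq_bigr => i _; rewrite (poly_mul_series_shift _ _ _ (szA i)).
by apply: eq_bigr => t _; rewrite /alpha (tnth_nth 0).
Qed.

End Shift.

(** * Weights as iterated vector-matrix products *)

Section Forward.
Variables (B : finType) (R : comNzRingType).

Definition forward_step (S : finType) (tr : S -> B -> S -> R)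
  (v : S -> R) (b : B) (y : S) : R := \sum_x v x * tr x b y.

Definition ffun_cons (S : finType) n (x : S * {ffun 'I_n -> S}) :
  {ffun 'I_n.+1 -> S} :=
  [ffun i => if unlift ord0 i is Some j then x.2 j else x.1].

Lemma ffun_cons_bij (S : finType) n : bijective (@ffun_cons S n).
Proof.
exists (fun s : {ffun 'I_n.+1 -> S} => (s ord0, [ffun i => s (lift ord0 i)])).
  move=> [x s]; rewrite /ffun_cons ffunE unlift_none /=; congr pair.
  by apply/ffunP => i; rewrite !ffunE liftK.
move=> s; apply/ffunP => i; rewrite !ffunE.
by case: unliftP => [j|] -> //; rewrite ffunE.
Qed.

(** Summing over the first state of a path turns the initial vector into its product with the
    transition matrix of b. *)
Lemma weight_cons (S : finType) (tr : S -> B -> S -> R) (ini fin : S -> R) b w :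
  weight (WAut tr ini fin) (b :: w) =
  weight (WAut tr (forward_step tr ini b) fin) w.
Proof.
rewrite /weight (reindex (@ffun_cons S (size w).+1)); last first.
  exact: onW_bij (ffun_cons_bij _ _).
under [RHS]eq_bigr do rewrite /path_weight /forward_step mulr_suml mulr_suml.
rewrite exchange_big pair_bigA; apply: eq_bigr => -[x s] _ /=.
rewrite /path_weight /= big_ord_recl.
have cons0 : ffun_cons (x, s) ord0 = x by rewrite ffunE unlift_none.
have consS i : ffun_cons (x, s) (lift ord0 i) = s i by rewrite ffunE liftK.
have -> : widen_ord (leqnSn (size w).+1) ord0 = ord0 by apply/val_inj.
have -> : ord_max = lift ord0 ord_max :> 'I_(size w).+2 by apply/val_inj.
rewrite cons0 !consS !mulrA; congr (_ * _ * _ * _).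
apply: eq_bigr => i _; rewrite consS.
have -> : widen_ord (leqnSn (size w).+1) (lift ord0 i) =
    lift ord0 (widen_ord (leqnSn (size w)) i) by apply/val_inj.
by rewrite consS !(tnth_nth b).
Qed.

Lemma weight_forward (M : waut B R) w :
  weight M w =
  \sum_x foldl (forward_step (@wa_trans _ _ M)) (@wa_init _ _ M) w x *
    wa_final x.
Proof.
case: M => S tr ini fin /=; elim: w ini => [|b w IH] ini /=; last first.
  by rewrite weight_cons IH.
rewrite /weight (reindex (fun x : S => [ffun _ : 'I_1 => x])); last first.
  exists (fun s : {ffun 'I_1 -> S} => s ord0) => [x|s] _; first by rewrite ffunE.
  by apply/ffunP => i; rewrite ffunE (ord1 i).
by apply: eq_bigr => x _; rewrite /path_weight big_ord0 !ffunE mulr1.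
Qed.

End Forward.

(** * Reading the defect through the window *)

Section Boxminus.

Definition boxminus_at N (u v : seq bool) : seq bbar :=
  [seq bdiff p.1 p.2 | p <- zip (lpad N u) (lpad N v)].

Lemma lpad_id N w : size w = N -> lpad N w = w.
Proof. by move=> <-; rewrite /lpad subnn. Qed.

Lemma boxminus_atE N u v : (size u <= N)%N -> (size v <= N)%N ->
  boxminus_at N u v =
  nseq (N - maxn (size u) (size v)) (bbar_of false) ++ boxminus u v.
Proof.
move=> le_u le_v; rewrite /boxminus; set M := maxn _ _.
have le_M : (M <= N)%N by rewrite geq_max le_u.
have lpadE w : (size w <= M)%N -> lpad N w = nseq (N - M) false ++ lpad M w.
  by move=> le_w; rewrite /lpad catA -nseqD; congr (nseq _ _ ++ _); lia.
have le_uM : (size u <= M)%N by rewrite leq_maxl.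
have le_vM : (size v <= M)%N by rewrite leq_maxr.
rewrite /boxminus_at !lpadE // zip_cat ?size_nseq // map_cat; congr (_ ++ _).
by elim: (_ - _)%N => //= k ->.
Qed.

Lemma foldl_boxminus_at (D : daut bbar bbar) N u v :
  defect_automaton D -> (size u <= N)%N -> (size v <= N)%N ->
  foldl (@da_trans _ _ D) (da_init D) (boxminus_at N u v) =
  da_run D (boxminus u v).
Proof.
move=> [D0 _] le_u le_v; rewrite boxminus_atE // foldl_cat; congr foldl.
by elim: (_ - _)%N => //= k IH; rewrite D0.
Qed.

(** As v is no longer than u, only zeros are subtracted from the letters of p. *)
Lemma map_bdiff_cat p u v N : (size v <= size u)%N -> (size p + size u = N)%N ->
  [seq bbar_of a | a <- p] ++ boxminus u v = boxminus_at N (p ++ u) v.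
Proof.
move=> le_v szN; rewrite /boxminus_at lpad_id ?size_cat //.
have -> : lpad N v = nseq (size p) false ++ lpad (size u) v.
  by rewrite /lpad catA -nseqD -szN; congr (nseq _ _ ++ _); lia.
rewrite zip_cat ?size_nseq // map_cat /boxminus (maxn_idPl le_v).
rewrite (lpad_id (erefl (size u))).
by congr (_ ++ _); elim: p {szN} => //= a p ->.
Qed.

(* p is the part of the padded input that has left the window u. *)
Lemma defect_window (D : daut bbar bbar) g w p u j :
  defect_automaton D -> no11 w -> (j <= zval w)%N ->
  nseq g false ++ w = p ++ u -> (size (zeck j) <= size u)%N ->
  \val (da_out (foldl (@da_trans _ _ D)
     (foldl (@da_trans _ _ D) (da_init D) [seq bbar_of a | a <- p])
     (boxminus u (zeck j)))) = defect (zval w - j) j.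
Proof.
move=> hD nw le_j E le_z; have [_ <- //] := hD.
rewrite -foldl_cat (map_bdiff_cat le_z (erefl _)) -E.
have [k wE] := no11_zeck nw; rewrite [X in _ ++ X]wE catA -nseqD.
set z := zeck (zval w).
have szN : (size p + size u = g + k + size z)%N.
  by rewrite -size_cat -E size_cat {1}wE size_cat !size_nseq addnA.
have -> : boxminus_at (size p + size u) (nseq (g + k) false ++ z) (zeck j) =
    boxminus_at (size p + size u) z (zeck j).
  rewrite /boxminus_at [lpad _ (nseq _ _ ++ _)]lpad_id ?size_cat ?size_nseq //.
  by rewrite /lpad szN addnK.
by rewrite foldl_boxminus_at // ?szN ?leq_addl // -szN; lia.
Qed.

End Boxminus.

(** The forward vectors are supported on a single pair (q, u), since these two components evolve
    deterministically. *)
Lemma sum_slice (R : nmodType) (I J Q U : finType) (F : I * J * Q * U -> R) q0 u0 :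
  (forall i j q u, (q, u) != (q0, u0) -> F (i, j, q, u) = 0) ->
  \sum_s F s = \sum_i \sum_j F (i, j, q0, u0).
Proof.
move=> F0; transitivity (\sum_(x : I * J) \sum_q \sum_u F (x, q, u)).
  by rewrite !pair_bigA; apply: eq_bigr => -[[x q] u].
rewrite [RHS]pair_bigA; apply: eq_bigr => -[i j] _ /=.
rewrite (bigD1 q0) //= [X in _ + X]big1 ?addr0 => [|q nq].
  rewrite (bigD1 u0) //= big1 ?addr0 // => u nu.
  by rewrite F0 // xpair_eqE negb_and nu orbT.
by rewrite big1 // => u _; rewrite F0 // xpair_eqE negb_and nq.
Qed.

(** * Correctness of the weighted automaton *)

Section Correctness.
Variables (R : comNzRingType) (d : nat) (A : d.-tuple {poly R}).
Variables (f : nat -> R) (D : daut bbar bbar).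
Hypotheses (sol : mahler_solution A f) (hD : defect_automaton D).
Let h := height A.
Let H := htilde h.
Let g := window h.

Definition forward (w : seq bool) : mstate D A -> R :=
  foldl (forward_step (@mtrans R D d A)) (minit (f 0%N)) w.

Lemma window_gt0 : (0 < g)%N.
Proof.
rewrite /g /window lt0n size_eq0; apply/eqP => z0.
by have := htilde_gt h; rewrite -(zeckK (htilde h)) z0 /zval big_ord0.
Qed.

(** The contribution of the transitions of type (1), where v j stands for the number l attached to
    the source. Its value is prescribed for j <= n only: the other sources carry the coefficient
    0. *)
Lemma sum_shift_trans (v : 'I_H.+1 -> int) (i : nat) n (b : bool) (k : 'I_H.+1) :
  ~~ (lastd n && b) ->
  (forall j : 'I_H.+1, (j <= n)%N ->
     v j = (zphi n)%:Z - (zphi (n - j)%N)%:Z + b%:Z) ->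
  \sum_(j < H.+1) shift (iter i (@Phi R) f) n j *
      (if (0 <= v j <= H%:Z) && (k%:Z == v j) then 1 else 0) =
  shift (iter i.+1 (@Phi R) f) (zphi n + b) k.
Proof.
move=> nb vE; rewrite /= (@shift_Phi _ h) // -/H; last by have := ltn_ord k; lia.
rewrite [RHS]big_mkcond; apply: eq_bigr => j _.
case: (leqP j n) => le_j; last by rewrite {1}/shift leqNgt le_j mul0r.
have le_z : (zphi (n - j) <= zphi n)%N by rewrite zphi_mono leq_subr.
rewrite vE //=.
have -> : (zphi n - zphi (n - j) + b == k)%N =
    (k%:Z == (zphi n)%:Z - (zphi (n - j)%N)%:Z + b%:Z) by apply/eqP/eqP; lia.
case: eqP => e; last by rewrite andbF mulr0.
by rewrite andbT ifT ?mulr1 //; have := ltn_ord k; lia.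
Qed.

(** The contribution of the transitions of type (2) from a fixed i. A source j meets only the term t
    = l - k, and k + t <= h + H is the range of [shift_Phi]. *)
Lemma sum_shift_trans0 (v : 'I_H.+1 -> int) (i : nat) n (b : bool) (k : 'I_H.+1) :
  ~~ (lastd n && b) ->
  (forall j : 'I_H.+1, (j <= n)%N ->
     v j = (zphi n)%:Z - (zphi (n - j)%N)%:Z + b%:Z) ->
  \sum_(j < H.+1) shift (iter i (@Phi R) f) n j *
      (if (0 <= v j) && (0 <= v j - k%:Z <= h%:Z) then
         alpha A i.+1 `|v j - k%:Z|%N else 0) =
  \sum_(t < h.+1)
    alpha A i.+1 t * shift (iter i.+1 (@Phi R) f) (zphi n + b) (k + t).
Proof.
move=> nb vE.
transitivity (\sum_(t < h.+1) \sum_(j < H.+1) alpha A i.+1 t *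
   (if (j <= n)%N && (zphi n - zphi (n - j) + b == k + t)%N
    then shift (iter i (@Phi R) f) n j else 0)); last first.
  apply: eq_bigr => t _; rewrite -mulr_sumr -big_mkcond /= -/H; congr (_ * _).
  by rewrite (@shift_Phi _ h) // -/H; have := ltn_ord k; have := ltn_ord t; lia.
rewrite exchange_big; apply: eq_bigr => j _ /=.
have le_z : (zphi (n - j) <= zphi n)%N by rewrite zphi_mono leq_subr.
case: (leqP j n) => le_j; last first.
  by rewrite /shift leqNgt le_j mul0r big1 // => t _; rewrite mulr0.
rewrite vE //=; set l := _ + _ + b%:Z.
have lE : l = (zphi n - zphi (n - j) + b)%N by rewrite /l; lia.
rewrite lE; set m := (_ - _ + b)%N; case: ifP => [in_h|out_h].
  have lt_t : (m - k < h.+1)%N by lia.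
  rewrite (bigD1 (Ordinal lt_t)) //= big1 ?addr0 => [|t].
    by rewrite ifT; [rewrite mulrC; congr (nth 0 _ _ * _); lia | apply/eqP; lia].
  rewrite -val_eqE /= => nt; rewrite ifF ?mulr0 //; lia.
rewrite mulr0 big1 // => t _; have := ltn_ord t => lt_t.
by rewrite ifF ?mulr0 //; move: out_h; lia.
Qed.

Lemma forwardE w : no11 w -> exists (p : seq bool) (u : g.-tuple bool),
  nseq g false ++ w = p ++ u /\
  forall i j q' u', forward w (i, j, q', u') =
    if (q' == foldl (@da_trans _ _ D) (da_init D) [seq bbar_of a | a <- p])
       && (u' == u)
    then shift (iter i (@Phi R) f) (zval w) j else 0.
Proof.
elim/last_ind: w => [_|w b IH].
  exists [::], (nseq_tuple g false); rewrite cats0; split=> // i j q u.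
  (* All the series Phi^i f have the same constant coefficient, in accordance with initial weights
     that do not depend on i. *)
  rewrite /forward /= /zval big_ord0 /shift leqn0 sub0n iter_Phi0 -/g.
  by case: eqP => //=; case: ifP.
rewrite no11_rcons => /andP[nw wb]; have [p [u [E fE]]] := IH nw.
set q0 := foldl _ _ _ in fE.
have szu : size (rcons (behead u) b) == g.
  by rewrite size_rcons size_behead size_tuple prednK // window_gt0.
have uE : u = head false u :: behead u :> seq bool.
  by have := window_gt0; case: (tval u) (size_tuple u) => [<-|].
exists (rcons p (head false u)), (Tuple szu); split.
  by rewrite /= cat_rcons -rcons_cat E {1}uE rcons_cat.
move=> i' k q' u'; rewrite /forward foldl_rcons -/(forward w) /forward_step.
rewrite map_rcons foldl_rcons -/q0.
rewrite (sum_slice (q0 := q0) (u0 := u)); last first.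
  by move=> i j q v; rewrite xpair_eqE fE => /negbTE ->; rewrite mul0r.
under eq_bigr do under eq_bigr do rewrite fE !eqxx /=.
have -> : (u' == Tuple szu) = (tval u' == rcons (behead u) b) by rewrite -val_eqE.
case: (q' =P _) => [_|_] /=; last first.
  by rewrite big1 // => i _; rewrite big1 // => j _; rewrite andbF mulr0.
case: (tval u' =P _) => [_|_] /=; last first.
  by rewrite big1 // => i _; rewrite big1 // => j _; rewrite andbF mulr0.
have -> : zval (rcons w b) = (zphi (zval w) + b)%N.
  by rewrite zphi_zval // -zval_rcons.
set n := zval w.
have nb : ~~ (lastd n && b) by rewrite lastd_zval.
set dh := fun j : 'I_H.+1 =>
  \val (da_out (foldl (@da_trans _ _ D) q0 (boxminus u (zeck j)))).
(* By the definition of the defect of n - j and j, the l of a transition is the gap zphi n - zphi (n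
   - j) plus b. *)
have vE (j : 'I_H.+1) : (j <= n)%N ->
    (zphi j)%:Z + dh j + b%:Z = (zphi n)%:Z - (zphi (n - j)%N)%:Z + b%:Z.
  move=> le_j; rewrite /dh (defect_window hD nw le_j E); last first.
    by rewrite size_tuple; apply: size_zeck_homo; rewrite -ltnS.
  by rewrite /defect subnK // -/n; ring.
(* The states with i' = 0 collect all sources i < d, which is the sum in the Mahler equation; those
   with i' > 0 are reached from i' - 1 only. *)
case: i' => -[|i'] lt_i' /=.
  rewrite (mahler_shift _ _ sol) big_ord_recr /= [X in _ + X]big1 ?addr0; last first.
    by move=> j _; rewrite ltnn mulr0.
  apply: eq_bigr => i _; rewrite ltn_ord -(sum_shift_trans0 _ _ nb vE).
  by apply: eq_bigr => j _; rewrite andbT.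
have lt_i : (i' < d.+1)%N by exact: ltnW.
rewrite (bigD1 (Ordinal lt_i)) //= [X in _ + X]big1 ?addr0; last first.
  move=> i; rewrite -val_eqE /= => ni; rewrite big1 // => j _.
  by rewrite eqSS [i' == i]eq_sym (negbTE ni) /=; case: ifP; rewrite mulr0.
rewrite -(sum_shift_trans _ _ nb vE).
by apply: eq_bigr => j _; rewrite -ltnS lt_i' eqxx.
Qed.

Lemma weight_mahler_waut w : no11 w ->
  weight (mahler_waut D A (f 0%N)) w = f (zval w).
Proof.
move=> nw; rewrite weight_forward -[foldl _ _ _]/(forward w).
have [p [u [_ fE]]] := forwardE nw.
set q0 := foldl _ _ _ in fE; rewrite (sum_slice (q0 := q0) (u0 := u)).
  rewrite (bigD1 ord0) //= (bigD1 ord0) //= fE !eqxx /= mulr1 /shift subn0.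
  rewrite !big1 ?addr0 // => [i ni | j nj].
    by rewrite big1 // => j _; rewrite -val_eqE /= in ni; rewrite (negbTE ni) mulr0.
  by rewrite -val_eqE /= in nj; rewrite (negbTE nj) mulr0.
by move=> i j q v; rewrite xpair_eqE fE => /negbTE ->; rewrite mul0r.
Qed.

End Correctness.

(** * Gaps of [zphi] and the deterministic automaton *)

Definition zphi_gap H n j : nat :=
  if (j <= n)%N then (zphi n - zphi (n - j))%N else H.*2.+1.

Lemma zphi_gap_lt H n j : (j <= H)%N -> (zphi_gap H n j < H.*2.+2)%N.
Proof.
by rewrite /zphi_gap => le_j; case: ifP => // _; have := zphi_sub_le n j; lia.
Qed.

(** A true gap is at most 2j <= 2H, so the default value 2H + 1 is distinguishable from it and equal
    gaps also decide j <= m and j <= n alike. *)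
Lemma zphi_gap_eq H m n j : (j <= H)%N -> zphi_gap H m j = zphi_gap H n j ->
  (j <= m)%N = (j <= n)%N /\
  ((j <= m)%N -> (zphi m - zphi (m - j) = zphi n - zphi (n - j))%N).
Proof.
rewrite /zphi_gap => le_j; have := zphi_sub_le m j; have := zphi_sub_le n j.
by case: ifP; case: ifP; lia.
Qed.

Section GapStep.
Variables (h m n : nat) (b : bool).
Let H := htilde h.
Hypotheses (mb : ~~ (lastd m && b)) (nb : ~~ (lastd n && b)).
Hypothesis gapE : forall j, (j <= H)%N -> zphi_gap H m j = zphi_gap H n j.

(* Whether m - j may be followed by a digit 1 is read off the gap of
   index j - 1, the value of zphi at m - j + 1 being involved. *)
Lemma zphi_gap_step l : (l <= H)%N -> (l <= zphi m + b)%N ->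
  zphi_gap H (zphi m + b) l = zphi_gap H (zphi n + b) l.
Proof.
move=> le_lH le_l; have [j [c [le_jm jc E]]] := zphi_sub_decomp mb le_l.
have zm_j : (zphi (m - j) <= zphi m)%N by rewrite zphi_mono leq_subr.
have zn_j : (zphi (n - j) <= zphi n)%N by rewrite zphi_mono leq_subr.
have le_jH : (j <= H)%N by apply: (@htildeP h m); rewrite -/H; lia.
have [le_jn /(_ le_jm) gap_j] := zphi_gap_eq le_jH (gapE le_jH).
rewrite le_jm in le_jn.
have jc' : ~~ (lastd (n - j) && c).
  case: c jc E => jc E; last by rewrite andbF.
  case: j => [|j] in le_jm le_jn le_jH gap_j zm_j zn_j jc E *.
    (* For j = 0, a digit c = 1 forces b = 1, and the hypothesis on n and b applies. *)
    rewrite !subn0 in E *; have : nat_of_bool b = 1%N by lia.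
    by move: nb; case: (b).
  have := zphiS (n - j.+1); have := zphiS (m - j.+1).
  have [_ ] := zphi_gap_eq (ltnW le_jH) (gapE (ltnW le_jH)).
  rewrite !subnSK // (ltnW le_jm) => /(_ isT).
  have : (zphi (m - j) <= zphi m)%N by rewrite zphi_mono leq_subr.
  have : (zphi (n - j) <= zphi n)%N by rewrite zphi_mono leq_subr.
  move: jc; case: (lastd (m - _)) => //=; case: (lastd (n - _)) => //=; lia.
rewrite /zphi_gap le_l (_ : l <= zphi n + b)%N; last by lia.
have -> : (zphi m + b - l = zphi (m - j) + c)%N by lia.
have -> : (zphi n + b - l = zphi (n - j) + c)%N by lia.
(* The new gap is zphi n - zphi (n - j) + j + 2b - 2c, the same expression as for m. *)
rewrite !zphi_zphi //; lia.
Qed.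

End GapStep.

Section Determinization.
Variables (R : finComNzRingType) (d : nat) (A : d.-tuple {poly R}).
Variable f : nat -> R.
Let h := height A.
Let H := htilde h.

Definition gap_series_state : finType :=
  ({ffun 'I_H.+1 -> 'I_H.*2.+2} * {ffun 'I_d * 'I_H.+1 -> R})%type.

Definition state_of (n : nat) : gap_series_state :=
  ([ffun j : 'I_H.+1 => inord (zphi_gap H n j)],
   [ffun x => shift (iter (val x.1) (@Phi R) f) n (val x.2)]).

Lemma state_ofP m n : state_of m = state_of n <->
  (forall j, (j <= H)%N -> zphi_gap H m j = zphi_gap H n j) /\
  (forall i j, (i < d)%N -> (j <= H)%N ->
     shift (iter i (@Phi R) f) m j = shift (iter i (@Phi R) f) n j).
Proof.
split=> [[/ffunP e1 /ffunP e2]|[e1 e2]]; first split.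
- move=> j le_j; have := e1 (inord j); rewrite !ffunE inordK //.
  by move/(congr1 val); rewrite /= !inordK // zphi_gap_lt.
- move=> i j lt_i le_j; have := e2 (Ordinal lt_i, inord j).
  by rewrite !ffunE /= inordK.
congr pair; [apply/ffunP => j|apply/ffunP => -[i j]]; rewrite !ffunE /=.
  by rewrite e1 // -ltnS.
by rewrite e2 // -ltnS.
Qed.

Lemma state_of_step m n (b : bool) : mahler_solution A f ->
  ~~ (lastd m && b) -> ~~ (lastd n && b) -> state_of m = state_of n ->
  state_of (zphi m + b) = state_of (zphi n + b).
Proof.
move=> sol mb nb /state_ofP[gapE serE]; apply/state_ofP.
(* The range goes up to h + H and includes Phi^d f, which is not stored: the Mahler equation
   expresses the coefficients of f through these. *)
have stepE i l : (i < d)%N -> (l <= h + H)%N ->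
    shift (iter i.+1 (@Phi R) f) (zphi m + b) l =
    shift (iter i.+1 (@Phi R) f) (zphi n + b) l.
  move=> lt_i le_l; rewrite /= !(shift_Phi _ _ le_l) //.
  apply: eq_big => [j|j /andP[le_j _]]; last by rewrite serE // -ltnS.
  have le_j : (j <= H)%N by rewrite -ltnS.
  have [e1 e2] := zphi_gap_eq le_j (gapE j le_j).
  by rewrite -e1; case: (leqP j m) e2 => //= _ ->.
split=> [l le_l|i l lt_i le_l].
  case: (leqP l (zphi m + b)) => le_m; first exact: zphi_gap_step.
  case: (leqP l (zphi n + b)) => le_n.
    by apply/esym; apply: zphi_gap_step => // j le_j; rewrite gapE.
  by rewrite /zphi_gap !ifF //; apply/negbTE; rewrite -ltnNge.
case: i lt_i => [|i] lt_i; last by apply: stepE; [exact: ltnW | lia].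
rewrite /= !(mahler_shift _ _ sol); apply: eq_bigr => i _; apply: eq_bigr => t _.
by rewrite stepE //; have := ltn_ord t; rewrite -/h; lia.
Qed.

(** The step is defined through a chosen representative n of the state that admits the digit b; by
    [state_of_step] the result does not depend on the choice. If there is no such n, the value is
    arbitrary. *)
Definition state_step (s : gap_series_state) (b : bool) : gap_series_state :=
  state_of (zphi (epsilon (inhabits 0%N)
    (fun n => state_of n = s /\ ~~ (lastd n && b))) + b).

Lemma state_stepE n (b : bool) : mahler_solution A f -> ~~ (lastd n && b) ->
  state_step (state_of n) b = state_of (zphi n + b).
Proof.
move=> sol nb; rewrite /state_step.
have [] := epsilon_spec (inhabits 0%N)
  (fun m => state_of m = state_of n /\ ~~ (lastd m && b)).
  by exists n.
by move=> e mb; apply: state_of_step.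
Qed.

Lemma exponent_gt0 : (0 < h)%N -> (0 < d)%N.
Proof.
case: (posnP d) => // d0; rewrite /h /height big1 // => i.
by have := ltn_ord i; rewrite {2}d0.
Qed.

(** The bound 2H + 2 <= |R|^(2H + 2) turns the cardinality into a power of |R| with exponent (2H + 2
    + d)(H + 1). As H <= 4h and d, h >= 1, the factors are at most 11dh and 5h, whence 55. *)
Lemma card_gap_series_state : (0 < h)%N ->
  (#|gap_series_state| <= #|R| ^ (55 * d * h ^ 2))%N.
Proof.
move=> h_gt0; have d_gt0 := exponent_gt0 h_gt0.
have le_H : (H <= 4 * h)%N := htilde_le h_gt0.
have R1 : (1 < #|R|)%N := card_finNzRing_gt1 R.
rewrite card_prod !card_ffun card_prod !card_ord.
have le2 : (H.*2.+2 <= #|R| ^ H.*2.+2)%N by exact: ltnW (ltn_expl _ R1).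
apply: (@leq_trans ((#|R| ^ H.*2.+2) ^ H.+1 * #|R| ^ (d * H.+1))%N).
  by rewrite leq_mul2r leq_exp2r ?le2 ?orbT.
rewrite -expnM -expnD leq_exp2l // -mulnDl.
have le_fst : (H.*2.+2 + d <= 11 * (d * h))%N by nia.
have le_snd : (H.+1 <= 5 * h)%N by lia.
by apply: leq_trans (leq_mul le_fst le_snd) _; rewrite -mulnn; lia.
Qed.

Lemma exists_generates : mahler_solution A f -> (0 < h)%N ->
  exists M : daut bool R,
    (#|da_state M| <= #|R| ^ (55 * d * h ^ 2))%N /\ generates M f.
Proof.
move=> sol h_gt0; have d_gt0 := exponent_gt0 h_gt0.
(* The output is the stored coefficient with i = j = 0, which is f_n in the state of n. *)
exists (DAut state_step (state_of 0) (fun s => s.2 (Ordinal d_gt0, ord0))).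
split; first exact: card_gap_series_state.
move=> n; rewrite /da_run /=.
have -> : foldl state_step (state_of 0) (zeck n) = state_of n.
  rewrite -[n in RHS]zeckK; have := zeck_no11 n.
  elim/last_ind: (zeck n) => [|w b IH]; first by rewrite /zval big_ord0.
  rewrite no11_rcons foldl_rcons => /andP[nw nb]; rewrite IH // state_stepE //.
    by rewrite zphi_zval // -zval_rcons.
  by rewrite lastd_zval.
by rewrite ffunE /= /shift subn0.
Qed.

End Determinization.

Theorem theorem29 :
  (forall (R : comNzRingType) (d : nat) (A : d.-tuple {poly R})
      (f : nat -> R) (D : daut bbar bbar),
    mahler_solution A f -> defect_automaton D ->
    forall w : seq bool, no11 w ->
      weight (mahler_waut D A (f 0%N)) w = f (zval w))
  /\
  (exists C : nat,
    forall (R : finComNzRingType) (d : nat) (A : d.-tuple {poly R})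
      (f : nat -> R),
    mahler_solution A f -> (0 < height A)%N ->
    exists M : daut bool R,
      (#|da_state M| <= #|R| ^ (C * d * height A ^ 2))%N /\ generates M f).
Proof.
split=> [R d A f D sol hD w nw|]; first exact: weight_mahler_waut.
exists 55%N => R d A f sol h_gt0; exact: exists_generates.
Qed.
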